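(* Let $p=(12,\{(0,0),(0,1),(1,2)\})$. Then, as formal power series in $t$ with coefficients in $\mathbb{Z}[y]$, $$\sum_{n\ge0}t^n\sum_{\pi\in S_n}y^{p(\pi)}=\cfrac{1}{1-\cfrac{\alpha_1t}{1-\cfrac{\alpha_2t}{1-\cdots}}}$$ with coefficients $\alpha_{2k-1}=k$ and $\alpha_{2k}=y+k-1$ for $k\ge1$.
   Context: $S_n$ is the set of permutations of $\{1,\dots,n\}$ in one-line notation ($S_0$ consists of the empty permutation). A mesh pattern of length $k$ is a pair $(\tau,R)$ with $\tau\in S_k$ and $R\subseteq\{0,\dots,k\}\times\{0,\dots,k\}$ (the set of shaded boxes). An occurrence of $(\tau,R)$ in $\pi\in S_n$ is a choice of positions $a_1<\cdots<a_k$ such that $\pi(a_1)\cdots\pi(a_k)$ is order-isomorphic to $\tau$ and, writing $v_1<\cdots<v_k$ for the values $\pi(a_1),\dots,\pi(a_k)$ sorted increasingly and $a_0=v_0=0$, $a_{k+1}=v_{k+1}=n+1$, for every $(i,j)\in R$ there is no position $c$ with $a_i<c<a_{i+1}$ and $v_j<\pi(c)<v_{j+1}$. For a mesh pattern $p$, $p(\pi)$ denotes the number of occurrences of $p$ in $\pi$. The infinite continued fraction is understood as a formal power series in $t$ (limit of its finite truncations in the $t$-adic topology). *)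

(* Defs.v *)
From HB Require Import structures.
From mathcomp Require Import all_boot all_order all_fingroup all_algebra.

Set Implicit Arguments.
Unset Strict Implicit.
Unset Printing Implicit Defensive.
Import GRing.Theory.
Local Open Scope ring_scope.

(* Permutations of {1, .., n} are elements of 'S_n, which act on
   'I_n = {0, .., n-1}: the 1-based position c and its value are [c.+1] and
   [(s c).+1].  Pairs in [mesh_shading] are (column, row). *)
Record mesh_pattern (k : nat) := MeshPattern {
  mesh_perm : 'S_k;
  mesh_shading : {set 'I_k.+1 * 'I_k.+1}
}.

Section MeshOccurrences.
Variables (k n : nat) (p : mesh_pattern k) (s : 'S_n).
Implicit Type a : {ffun 'I_k -> 'I_n}.

Definition increasing_positions a : bool :=
  [forall i : 'I_k, forall j : 'I_k, (i < j)%N ==> (a i < a j)%N].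

Definition order_isomorphic a : bool :=
  [forall i : 'I_k, forall j : 'I_k,
     (s (a i) < s (a j))%N == (mesh_perm p i < mesh_perm p j)%N].

(* [:: a_0; a_1; ..; a_k; a_(k+1)] with a_0 = 0 and a_(k+1) = n + 1 *)
Definition position_lines a : seq nat :=
  0%N :: rcons [seq (a i).+1 | i <- enum 'I_k] n.+1.

(* [:: v_0; v_1; ..; v_k; v_(k+1)] with v_0 = 0 and v_(k+1) = n + 1 *)
Definition value_lines a : seq nat :=
  0%N :: rcons (sort leq [seq (s (a i)).+1 | i <- enum 'I_k]) n.+1.

Definition in_box a (i j : nat) (c : 'I_n) : bool :=
  [&& (nth 0%N (position_lines a) i < c.+1)%N,
      (c.+1 < nth 0%N (position_lines a) i.+1)%N,
      (nth 0%N (value_lines a) j < (s c).+1)%N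
    & ((s c).+1 < nth 0%N (value_lines a) j.+1)%N].

Definition occurrence a : bool :=
  [&& increasing_positions a, order_isomorphic a
    & [forall b in mesh_shading p, ~~ [exists c, in_box a b.1 b.2 c]]].

Definition mesh_count : nat := #|[set a | occurrence a]|.

End MeshOccurrences.

Section FormalPowerSeries.
Variable R : nzRingType.

(* f n is the coefficient of t^n *)
Definition fps := nat -> R.
Implicit Types f g : fps.

Definition fps1 : fps := fun n => (n == 0%N)%:R.
Definition fpsT : fps := fun n => (n == 1%N)%:R.
Definition fps_sub f g : fps := fun n => f n - g n.
Definition fps_scale (c : R) f : fps := fun n => c * f n.
Definition fps_mul f g : fps := fun n => \sum_(i < n.+1) f i * g (n - i)%N.
Definition fps_exp f (k : nat) : fps := iter k (fps_mul f) fps1.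

(* The inverse of a series with constant coefficient 1, as the geometric series
   in 1 - f: powers of 1 - f above the n-th do not contribute to t^n.
   See fps_mulV. *)
Definition fps_inv f : fps :=
  fun n => \sum_(k < n.+1) fps_exp (fps_sub fps1 f) k n.

Lemma fps_exp_small f k n : f 0%N = 0 -> (n < k)%N -> fps_exp f k n = 0.
Proof.
move=> f0; elim: k n => [|k IHk] n //; rewrite ltnS => le_nk.
rewrite /fps_exp iterS; apply: big1 => -[[|i] /= lt_in] _.
  by rewrite f0 mul0r.
rewrite -/(fps_exp f k) IHk ?mulr0 //.
by apply: leq_trans le_nk; rewrite ltn_subrL /=; case: n lt_in.
Qed.

Lemma fps_mulV f : f 0%N = 1 -> forall n, fps_mul f (fps_inv f) n = fps1 n.
Proof.
move=> f0 n; set h := fps_sub fps1 f.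
have h0 : h 0%N = 0 by rewrite /h /fps_sub f0 subrr.
have hg : fps_mul h (fps_inv f) n = \sum_(k < n.+1) fps_exp h k.+1 n.
  rewrite /fps_exp; under [RHS]eq_bigr do rewrite iterS.
  rewrite [RHS]exchange_big; apply: eq_bigr => i _ /=.
  rewrite -mulr_sumr -/h; congr (_ * _).
  have le_n : ((n - i).+1 <= n.+1)%N by rewrite ltnS leq_subr.
  rewrite /fps_inv (big_ord_widen _ (fun k => fps_exp h k (n - i)%N) le_n).
  rewrite big_mkcond; apply: eq_bigr => k _; case: ifPn => //.
  by rewrite ltnS -ltnNge => lt_k; rewrite -/(fps_exp h k) fps_exp_small.
have -> : fps_mul f (fps_inv f) n = fps_inv f n - fps_mul h (fps_inv f) n.
  have -> : fps_inv f n = fps_mul fps1 (fps_inv f) n.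
    rewrite /fps_mul big_ord_recl /= mul1r subn0 big1 ?addr0 // => i _.
    by rewrite /fps1 /= mul0r.
  rewrite /fps_mul -sumrB; apply: eq_bigr => i _.
  by rewrite -mulrBl /h /fps_sub opprB addrCA subrr addr0.
have tele (F : nat -> R) :
    \sum_(k < n.+1) F k - \sum_(k < n.+1) F k.+1 = F 0%N - F n.+1.
  rewrite [X in X - _]big_ord_recl [X in _ - X]big_ord_recr /= opprD addrA.
  by congr (_ - _); apply: addrK.
rewrite hg /fps_inv -/h (tele (fun k => fps_exp h k n)).
by rewrite (fps_exp_small h0 (ltnSn n)) subr0.
Qed.

(* The truncation with m levels, starting at a_j:
   1 / (1 - a_j t / (1 - .. / (1 - a_(j+m-1) t))). *)
Fixpoint sfraction (a : nat -> R) (j m : nat) : fps :=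
  if m is m'.+1 then
    fps_inv (fps_sub fps1 (fps_mul (fps_scale (a j) fpsT)
                                   (sfraction a j.+1 m')))
  else fps1.

Definition fps_cvg (u : nat -> fps) f : Prop :=
  forall N : nat, exists M : nat, forall m : nat, (M <= m)%N ->
    forall n : nat, (n < N)%N -> u m n = f n.

(* [f] equals the infinite continued fraction 1 / (1 - a_1 t / (1 - ..)). *)
Definition is_sfraction (f : fps) (a : nat -> R) : Prop :=
  fps_cvg (sfraction a 1%N) f.

End FormalPowerSeries.

Definition pattern_p : mesh_pattern 2 :=
  MeshPattern 1%g
    [set (inord 0, inord 0); (inord 0, inord 1); (inord 1, inord 2)].

(* The variable y is 'X : {poly int}. *)
Definition mesh_series (k : nat) (p : mesh_pattern k) : fps {poly int} :=
  fun n => \sum_(s : 'S_n) 'X ^+ mesh_count p s.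

(* Main.v *)
Require Import Defs.
From mathcomp Require Import all_boot all_order all_fingroup all_algebra.
From mathcomp Require Import ring zify.
Import GRing.Theory.
Local Open Scope ring_scope.

Set Implicit Arguments.
Unset Strict Implicit.

(* An occurrence of the pattern is determined by its right end [j]: it starts
   at [i] exactly when the values before position [i] exceed [s j] and those
   in positions [i, .., j-1] are smaller.  Encode [s] by its code, whose entry
   [c_j] is the number of larger values to the left of position [j].  Then [j]
   ends an occurrence iff [c_j < j] and [c_j] is a skew cut of the prefix, i.e.
   the first [c_j] values of the prefix exceed all the others.  Choosing the
   last entry of the code, and splitting codes at a skew cut [i], gives
     P_(n+1) = (n+1) P_n + (y - 1) sum_(i < n) P_i P_(n-i).
   This Riccati equation is solved by 2F0(1, y; t) / 2F0(1, y-1; t), the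
   continued fraction of which is due to Euler. *)

(** * Power series computed as polynomials modulo a power of ['X] *)

Section TruncatedSeries.
Variable R : comNzRingType.
Implicit Types (f g : fps R) (p q : {poly R}).

Definition trunc N f : {poly R} := \poly_(i < N) f i.

Lemma coef_trunc N f n : (n < N)%N -> (trunc N f)`_n = f n.
Proof. by rewrite coef_poly => ->. Qed.

Lemma coef_trunc_mul N f g n :
  (n < N)%N -> (trunc N f * trunc N g)`_n = fps_mul f g n.
Proof.
move=> lt_nN; rewrite coefM; apply: eq_bigr => i _.
by rewrite !coef_trunc // (leq_ltn_trans _ lt_nN) ?leq_subr // -ltnS.
Qed.

(** The explicit remainder turns a congruence modulo ['X^N] into a polynomial identity, on which
    [ring] can work. *)
Lemma eq_coef_mod N p q :
  (forall n, (n < N)%N -> p`_n = q`_n) -> exists r, p = q + r * 'X^N.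
Proof.
move=> eq_pq; exists (drop_poly N (p - q)).
rewrite -{1}[p](subrK q) -{1}(poly_take_drop N (p - q)).
suff -> : take_poly N (p - q) = 0 by rewrite add0r addrC.
apply/polyP => n; rewrite coef_take_poly coef0; case: ifP => // lt_nN.
by rewrite coefB eq_pq // subrr.
Qed.

Lemma coef_mod_eq N p q r n :
  p = q + r * 'X^N -> (n < N)%N -> p`_n = q`_n.
Proof. by move=> -> lt_nN; rewrite coefD coefMXn lt_nN addr0. Qed.

Lemma fps_mulT (c : R) f n :
  fps_mul (fps_scale c (@fpsT R)) f n = if n is n'.+1 then c * f n' else 0.
Proof.
rewrite /fps_mul /fps_scale /fpsT; case: n => [|n].
  by rewrite big_ord1 mulr0 mul0r.
rewrite !big_ord_recl big1 /= => [|i _]; last by rewrite mulr0 mul0r.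
by rewrite mulr0 mul0r add0r mulr1 addr0 subSS subn0.
Qed.

Lemma fps_mulI f g h N :
  f 0%N = 1 ->
  (forall n, (n < N)%N -> fps_mul g f n = fps_mul h f n) ->
  forall n, (n < N)%N -> g n = h n.
Proof.
move=> f0 eq_gh.
have [r1 E1] : exists r, trunc N f * trunc N (fps_inv f) = 1 + r * 'X^N.
  by apply: eq_coef_mod => n lt_nN; rewrite coef_trunc_mul // fps_mulV // coef1.
have [r2 E2] : exists r, trunc N g * trunc N f
                         = trunc N h * trunc N f + r * 'X^N.
  by apply: eq_coef_mod => n lt_nN; rewrite !coef_trunc_mul // eq_gh.
move=> n lt_nN; rewrite -(coef_trunc g lt_nN) -(coef_trunc h lt_nN).
apply: (coef_mod_eq (N := N)
  (r := r2 * trunc N (fps_inv f) - trunc N g * r1 + trunc N h * r1)) => //.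
transitivity (trunc N g * trunc N f * trunc N (fps_inv f)
              - trunc N g * r1 * 'X^N); first by rewrite -mulrA E1; ring.
transitivity (trunc N h * (trunc N f * trunc N (fps_inv f))
  + (r2 * trunc N (fps_inv f) - trunc N g * r1) * 'X^N).
  by rewrite E2; ring.
by rewrite E1; ring.
Qed.

(* Euler's method: the three-term relation makes [g i.+1 / g i] the tail of
   the continued fraction starting at [a i.+1]. *)
Lemma sfraction_ratio (a : nat -> R) (g : nat -> fps R) :
  (forall i, g i 0%N = 1) ->
  (forall i n, g i.+1 n.+1 - g i n.+1 = a i.+1 * g i.+2 n) ->
  forall m i n, (n <= m)%N ->
    fps_mul (sfraction a i.+1 m) (g i) n = g i.+1 n.
Proof.
move=> g0 grec; elim=> [|m IHm] i n le_nm.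
  case: n le_nm => // _.
  by rewrite /fps_mul big_ord1 /= /fps1 mul1r !g0.
set S := sfraction a i.+2 m.
set d := fps_sub (@fps1 R) (fps_mul (fps_scale (a i.+1) (@fpsT R)) S).
have -> : sfraction a i.+1 m.+1 = fps_inv d by [].
have d0 : d 0%N = 1 by rewrite /d /fps_sub fps_mulT subr0.
(* Multiplication by t gains one order: the tail known modulo ['X^(m.+1)] determines the fraction
   modulo ['X^(m.+2)]. *)
pose N := m.+2; pose t := @trunc N.
have [r1 E1] : exists r, trunc N S * trunc N (g i.+1)
                         = trunc N (g i.+2) + r * 'X^(m.+1).
  apply: eq_coef_mod => k lt_k.
  have lt_kN : (k < N)%N by apply: ltnW.
  by rewrite coef_trunc_mul // coef_trunc // IHm.
have [r2 E2] : exists r, (1 - (a i.+1)%:P * ('X * trunc N S))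
                          * trunc N (fps_inv d) = 1 + r * 'X^N.
  have [r Er] : exists r, 1 - (a i.+1)%:P * ('X * trunc N S)
                          = trunc N d + r * 'X^N.
    apply: eq_coef_mod => k lt_k; rewrite coef_trunc //.
    rewrite coefB coef1 coefCM coefXM /d /fps_sub fps_mulT /fps1.
    case: k lt_k => [|k] lt_k /=; first by rewrite mulr0.
    by rewrite coef_trunc // ltnW.
  have [r' Er'] : exists r, trunc N d * trunc N (fps_inv d) = 1 + r * 'X^N.
    apply: eq_coef_mod => k lt_k.
    by rewrite coef_trunc_mul // fps_mulV // coef1.
  exists (r' + r * trunc N (fps_inv d)).
  by rewrite Er mulrDl Er'; ring.
have [r3 E3] : exists r, trunc N (g i.+1)
    - (a i.+1)%:P * ('X * trunc N (g i.+2)) = trunc N (g i) + r * 'X^N.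
  apply: eq_coef_mod => k lt_k.
  rewrite coefB coefCM coefXM; case: k lt_k => [|k] lt_k /=.
    by rewrite !coef_trunc // mulr0 subr0 !g0.
  by rewrite !coef_trunc ?(ltnW lt_k) // -grec opprB addrC subrK.
have lt_nN : (n < N)%N by [].
rewrite -(coef_trunc_mul _ _ lt_nN) -(coef_trunc (g i.+1) lt_nN).
apply: (coef_mod_eq (N := N) (r := trunc N (g i.+1) * r2
  + trunc N (fps_inv d) * ((a i.+1)%:P * r1 - r3))) => //.
set I := trunc N (fps_inv d).
transitivity (I * (trunc N (g i.+1)
    - (a i.+1)%:P * ('X * trunc N (g i.+2)) - r3 * 'X^N)).
  by rewrite E3 addrK.
transitivity (I * (trunc N (g i.+1) - (a i.+1)%:P
    * ('X * (trunc N S * trunc N (g i.+1) - r1 * 'X^(m.+1))) - r3 * 'X^N)).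
  by rewrite E1 addrK.
transitivity (trunc N (g i.+1) * ((1 - (a i.+1)%:P * ('X * trunc N S)) * I)
    + I * ((a i.+1)%:P * r1 - r3) * 'X^N); last by rewrite E2; ring.
by rewrite /N !exprS; ring.
Qed.

(** * Rising factorials, Euler's contiguous relations and the Riccati equation *)

Definition rising (x : R) n : R := \prod_(i < n) (x + i%:R).

Lemma risingS x n : rising x n.+1 = rising x n * (x + n%:R).
Proof. by rewrite /rising big_ord_recr. Qed.

Lemma risingSl x n : rising x n.+1 = x * rising (x + 1) n.
Proof.
rewrite /rising big_ord_recl /= addr0; congr (_ * _).
by apply: eq_bigr => i _; rewrite /bump /= add1n -addrA -natr1 [i%:R + 1]addrC.
Qed.

(* The coefficients of 2F0(i./2 + 1, y + uphalf i - 1; t). *)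
Definition euler_series (y : R) i : fps R :=
  fun n => 'C(n + i./2, n)%:R * rising (y + (uphalf i)%:R - 1) n.

Lemma euler_series0 y i : euler_series y i 0%N = 1.
Proof. by rewrite /euler_series /rising big_ord0 bin0 mulr1. Qed.

(** Both rising factorials contain [rising b n], with [b = y + k]; the remaining factors [b + n] and
    [b - 1] differ by n + 1, which the binomial coefficient trades for k + 1. *)
Lemma euler_seriesB_even y k n :
  euler_series y k.*2.+1 n.+1 - euler_series y k.*2 n.+1
  = k.+1%:R * euler_series y k.*2.+2 n.
Proof.
rewrite /euler_series /= uphalf_double half_double.
set b := y + k%:R.
have -> : y + k.+1%:R - 1 = b by rewrite /b; ring.
rewrite (risingS b) (risingSl (b - 1)) subrK.
have binE : (n.+1 * 'C(n.+1 + k, n.+1) = k.+1 * 'C(n + k.+1, n))%N.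
  by rewrite mul_bin_left addSnnS; congr (_ * _)%N; lia.
have {}binE : n.+1%:R * 'C(n.+1 + k, n.+1)%:R = k.+1%:R * 'C(n + k.+1, n)%:R :> R.
  by rewrite -!natrM binE.
rewrite [RHS]mulrA -binE.
ring.
Qed.

(** The two rising factorials agree, so the difference is Pascal's rule. *)
Lemma euler_seriesB_odd y k n :
  euler_series y k.*2.+2 n.+1 - euler_series y k.*2.+1 n.+1
  = (y + k%:R) * euler_series y k.*2.+3 n.
Proof.
rewrite /euler_series /= uphalf_double half_double.
set b := y + k%:R.
have -> : y + k.+2%:R - 1 = b + 1 by rewrite /b; ring.
have -> : y + k.+1%:R - 1 = b by rewrite /b; ring.
rewrite risingSl -mulrBl.
have -> : 'C(n.+1 + k.+1, n.+1) = ('C(n.+1 + k, n.+1) + 'C(n + k.+1, n))%N.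
  by rewrite addSn addnS binS addSnnS addnS.
by rewrite natrD; ring.
Qed.

(* Let [F], [G], [H] be the series of [u], of [rising y] and of [rising (y-1)].
   The recurrence says that [F] solves a Riccati equation, and the linear
   equations for [G] and [H] turn it, for [E = F * H - G], into
   [E = t * (t * E^`() + E + (y - 1) * F * E)], which forces [E = 0]. *)
Lemma riccati_rising (y : R) (u : fps R) :
  u 0%N = 1 ->
  (forall n, u n.+1
     = n.+1%:R * u n + (y - 1) * \sum_(i < n) u i * u (n - i)%N) ->
  forall n, fps_mul u (rising (y - 1)) n = rising y n.
Proof.
move=> u0 urec n; pose N := n.+1.
set F := trunc N u; set G := trunc N (rising y).
pose w := (y - 1)%:P : {poly R}; pose H := 1 + w * ('X * G).
have [r0 E0] : exists r, trunc N (rising (y - 1)) = H + r * 'X^N.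
  apply: eq_coef_mod => k lt_k; rewrite coef_trunc // coefD coef1 coefCM coefXM.
  case: k lt_k => [|k] lt_k /=; first by rewrite mulr0 addr0 /rising big_ord0.
  by rewrite add0r coef_trunc ?(ltnW lt_k) // risingSl subrK.
(* The recurrence omits the last term [u k * u 0 = u k] of the convolution; hence [F * F - F]. *)
have [r1 E1] : exists r,
    F = (1 + 'X * (F + 'X * F^`() + w * (F * F - F))) + r * 'X^N.
  apply: eq_coef_mod => k lt_k; rewrite coefD coef1 coefXM coef_trunc //.
  case: k lt_k => [|k] lt_k /=; first by rewrite addr0.
  have lt_k' : (k < N)%N by apply: ltnW.
  rewrite !coefD coefCM coefB coefXM coef_trunc_mul // coef_trunc //.
  have -> : (if k == 0%N then 0 else F^`()`_k.-1) = k%:R * u k.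
    case: k {lt_k} lt_k' => [|k] lt_k /=; first by rewrite mul0r.
    by rewrite coef_deriv coef_trunc // mulr_natl.
  rewrite add0r urec /fps_mul big_ord_recr /= subnn u0 mulr1 addrK.
  by rewrite -natr1; ring.
have [r2 E2] : exists r,
    G = (1 + 'X * (y%:P * G + 'X * G^`())) + r * 'X^N.
  apply: eq_coef_mod => k lt_k; rewrite coefD coef1 coefXM coef_trunc //.
  case: k lt_k => [|k] lt_k /=; first by rewrite addr0 /rising big_ord0.
  have lt_k' : (k < N)%N by apply: ltnW.
  rewrite !coefD coefCM coefXM coef_trunc //.
  have -> : (if k == 0%N then 0 else G^`()`_k.-1) = k%:R * rising y k.
    case: k {lt_k} lt_k' => [|k] lt_k /=; first by rewrite mul0r.
    by rewrite coef_deriv coef_trunc // mulr_natl.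
  by rewrite add0r risingS; ring.
pose E := F * H - G.
have [r3 E3] : exists r, E = 'X * ('X * E^`() + E + w * (F * E)) + r * 'X^N.
  have dE : E^`() = F^`() * H + F * (w * (G + 'X * G^`())) - G^`().
    by rewrite /E /H !derivE /w; ring.
  (* [H] and [c] are the cofactors with which [E1] and [E2] combine into the equation for [E]. *)
  pose c := 1 - w * 'X * F.
  exists (H * r1 - c * r2); apply/eqP; rewrite -subr_eq0 dE; apply/eqP.
  transitivity (H * (F - (1 + 'X * (F + 'X * F^`() + w * (F * F - F))
                          + r1 * 'X^N))
    + c * ((1 + 'X * (y%:P * G + 'X * G^`()) + r2 * 'X^N) - G)).
    by rewrite /c /E /H /w polyCB; ring.
  by rewrite -E1 -E2 !subrr !mulr0 addr0.
have FHE : F * H = E + G by rewrite /E subrK.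
clearbody E.
(* The outer factor ['X] makes each coefficient of [E] depend on lower ones only. *)
have Ez k : (k < N)%N -> E`_k = 0.
  elim/ltn_ind: k => -[|k] IHk lt_k.
    by rewrite (coef_mod_eq E3) // coefXM.
  have lt_k' : (k < N)%N by apply: ltnW.
  rewrite (coef_mod_eq E3) // coefXM /= !coefD coefXM coefCM coefM.
  rewrite big1 => [|i _]; last first.
    by rewrite IHk ?mulr0 // (leq_ltn_trans (leq_subr i k)).
  rewrite (IHk k) // mulr0 !addr0; case: k IHk {lt_k} lt_k' => [|k] IHk lt_k //=.
  by rewrite coef_deriv IHk // mul0rn.
rewrite -(coef_trunc_mul _ _ (ltnSn n)) -(coef_trunc (rising y) (ltnSn n)).
rewrite (coef_mod_eq (N := N) (q := E + G) (r := F * r0)) //.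
  by rewrite coefD Ez // add0r.
by rewrite E0 -FHE mulrDr mulrA.
Qed.

End TruncatedSeries.

(** * The pattern statistic on codes *)

Section Codes.
Local Open Scope nat_scope.
Implicit Types c d e : seq nat.

(* If [c] is the code of [s], the first [i] values of [s] exceed the others. *)
Definition skew_cut c i : bool := all (leq i) (drop i c).

Definition code_hit c b : bool :=
  (nth 0 c b < b) && skew_cut (take b c) (nth 0 c b).

Definition code_count c : nat := \sum_(b < size c) code_hit c b.

Lemma code_hit_cat c d b :
  b < size c -> code_hit (c ++ d) b = code_hit c b.
Proof.
move=> lt_b; rewrite /code_hit nth_cat take_cat lt_b //.
Qed.

Lemma code_count_rcons c v :
  code_count (rcons c v) = code_count c + ((v < size c) && skew_cut c v).
Proof.
rewrite /code_count size_rcons big_ord_recr /= -cats1; congr (_ + _).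
  by apply: eq_bigr => b _; rewrite code_hit_cat.
by rewrite /code_hit nth_cat ltnn subnn take_size_cat.
Qed.

(** A hit depends only on the entries up to it. In the shifted block both sides of each comparison
    grow by [size d], and the cut discards all of [d]. *)
Lemma code_count_skew d e :
  code_count (d ++ map (addn (size d)) e) = code_count d + code_count e.
Proof.
rewrite /code_count size_cat size_map big_split_ord /=; congr (_ + _).
  by apply: eq_bigr => b _; rewrite code_hit_cat.
apply: eq_bigr => b _; congr nat_of_bool.
have addF m : (size d + m < size d) = false by rewrite ltnNge leq_addr.
rewrite /code_hit nth_cat take_cat addF addKn (nth_map 0) // ltn_add2l -map_take.
rewrite /skew_cut drop_cat addF addKn -map_drop all_map; congr (_ && _).
by apply: eq_all => x /=; rewrite leq_add2l.
Qed.

Lemma skew_cut_rcons c v i :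
  i <= size c -> skew_cut (rcons c v) i = skew_cut c i && (i <= v).
Proof.
by move=> le_i; rewrite /skew_cut drop_rcons // all_rcons andbC.
Qed.

Lemma skew_cut_size c : skew_cut c (size c).
Proof. by rewrite /skew_cut drop_size. Qed.

End Codes.

(** * Sums over codes and the recurrence for their generating polynomials *)

Section CodeSums.
Variable R : comNzRingType.
Implicit Types f g : seq nat -> R.

(* The sum of [f c] over the sequences [c] of length [n] with [c_j <= j]. *)
Fixpoint code_sum n f : R :=
  if n is m.+1 then code_sum m (fun c => \sum_(v < m.+1) f (rcons c v))
  else f [::].

Lemma eq_code_sum n f g :
  (forall c, size c = n -> f c = g c) -> code_sum n f = code_sum n g.
Proof.
elim: n f g => [|n IHn] f g eq_fg /=; first exact: eq_fg.
apply: IHn => c sz_c; apply: eq_bigr => v _.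
by rewrite eq_fg // size_rcons sz_c.
Qed.

Lemma code_sumD n f g :
  code_sum n (fun c => f c + g c) = code_sum n f + code_sum n g.
Proof.
elim: n f g => [|n IHn] f g //=.
by rewrite -IHn; apply: eq_code_sum => c _; rewrite big_split.
Qed.

Lemma code_sumZ n (x : R) f :
  code_sum n (fun c => x * f c) = x * code_sum n f.
Proof.
elim: n f => [|n IHn] f //=.
by rewrite -IHn; apply: eq_code_sum => c _; rewrite mulr_sumr.
Qed.

Lemma code_sum_sum n m (F : 'I_m -> seq nat -> R) :
  code_sum n (fun c => \sum_(i < m) F i c) = \sum_(i < m) code_sum n (F i).
Proof.
elim: n F => [|n IHn] F //=.
by rewrite -IHn; apply: eq_code_sum => c _; rewrite exchange_big.
Qed.

(** Past a cut at [i], the bounds [i <= c_j <= j] become those of a code of length [m] once [i] is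
    subtracted. *)
Lemma code_sum_cut i m f :
  code_sum (i + m) (fun c => f c * (skew_cut c i)%:R)
  = code_sum i (fun d => code_sum m (fun e => f (d ++ map (addn i) e))).
Proof.
elim: m f => [|m IHm] f /=.
  rewrite addn0; apply: eq_code_sum => c <-.
  by rewrite skew_cut_size mulr1 cats0.
rewrite addnS /=.
transitivity (code_sum (i + m) (fun c =>
    (\sum_(u < m.+1) f (rcons c (i + u)%N)) * (skew_cut c i)%:R)).
  apply: eq_code_sum => c sz_c.
  rewrite -(big_mkord xpredT
    (fun v => f (rcons c v) * (skew_cut (rcons c v) i)%:R)).
  (* Last entries below [i] break the cut and drop out; the others are [i + u]. *)
  rewrite -addnS big_mkord big_split_ord /= big1 => [|v _].
    rewrite add0r mulr_suml; apply: eq_bigr => u _.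
    by rewrite skew_cut_rcons ?sz_c ?leq_addr // andbT.
  by rewrite skew_cut_rcons ?sz_c ?leq_addr // leqNgt ltn_ord andbF mulr0.
rewrite IHm; apply: eq_code_sum => d _; apply: eq_code_sum => e _.
by apply: eq_bigr => u _; rewrite map_rcons rcons_cat.
Qed.

Definition code_poly (y : R) n : R := code_sum n (fun c => y ^+ code_count c).

Lemma code_poly0 y : code_poly y 0 = 1.
Proof. by rewrite /code_poly /= /code_count big_ord0. Qed.

Lemma code_polyS y n :
  code_poly y n.+1 = n.+1%:R * code_poly y n
    + (y - 1) * \sum_(i < n) code_poly y i * code_poly y (n - i).
Proof.
(* For a bit b, y^b = 1 + (y - 1) b, so the hit condition enters linearly. *)
have expE c v : y ^+ code_count (rcons c v) = y ^+ code_count c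
    + (y - 1) * (y ^+ code_count c * ((v < size c)%N && skew_cut c v)%:R).
  rewrite code_count_rcons exprD; case: (_ && _).
    by rewrite /= expr1; ring.
  by rewrite /= expr0; ring.
rewrite {1}/code_poly /=.
transitivity (code_sum n (fun c => n.+1%:R * y ^+ code_count c
    + (y - 1) * \sum_(i < n) y ^+ code_count c * (skew_cut c i)%:R)).
  apply: eq_code_sum => c sz_c; under eq_bigr do rewrite expE.
  rewrite big_split /= sumr_const card_ord mulr_natl -mulr_sumr.
  (* The choice v = n is never a hit, so the sum stops before [n]. *)
  rewrite big_ord_recr /= sz_c ltnn mulr0 addr0; congr (_ + _ * _).
  by apply: eq_bigr => i _; rewrite ltn_ord.
rewrite code_sumD !code_sumZ code_sum_sum; congr (_ + _ * _).
apply: eq_bigr => i _; have le_i : (i <= n)%N by apply: ltnW.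
rewrite -{1}(subnKC le_i) code_sum_cut mulrC -code_sumZ.
apply: eq_code_sum => d sz_d; rewrite mulrC -code_sumZ.
by apply: eq_code_sum => e _; rewrite -sz_d code_count_skew exprD.
Qed.

End CodeSums.

(** * The correspondence between permutations and codes *)

Section PermutationCodes.
Local Open Scope nat_scope.

Definition nlarger n (s : 'S_n) (j : 'I_n) : nat :=
  \sum_(i < n) ((i < j) && (s j < s i)).

Definition perm_code n (s : 'S_n) : seq nat :=
  [seq nlarger s j | j <- enum 'I_n].

Lemma size_perm_code n (s : 'S_n) : size (perm_code s) = n.
Proof. by rewrite size_map size_enum_ord. Qed.

Lemma nth_perm_code n (s : 'S_n) (j : 'I_n) :
  nth 0 (perm_code s) j = nlarger s j.
Proof. by rewrite (nth_map j) ?size_enum_ord // nth_ord_enum. Qed.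

Lemma ltn_bump2 h i j : (bump h i < bump h j) = (i < j).
Proof. by rewrite !ltnNge leq_bump2. Qed.

Lemma sum_leq_ord n v : \sum_(i < n) (v <= i) = n - v.
Proof.
elim: n => [|n IHn]; first by rewrite big_ord0.
by rewrite big_ord_recr /= IHn; case: (leqP v n) => ?; lia.
Qed.

Lemma sum_ltn_ord n v : \sum_(i < n) (i < v) = minn n v.
Proof.
elim: n => [|n IHn]; first by rewrite big_ord0 min0n.
by rewrite big_ord_recr /= IHn; case: (ltnP n v) => ?; lia.
Qed.

(** Appending the value [v] keeps the relative order of the others, and exactly the [n - v] values
    of [s] that are at least [v] are lifted above it. *)
Lemma perm_code_lift n (v : 'I_n.+1) (s : 'S_n) :
  perm_code (lift_perm ord_max v s) = rcons (perm_code s) (n - v).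
Proof.
have widenE (i : 'I_n) : widen_ord (leqnSn n) i = lift ord_max i.
  by apply: val_inj; rewrite /= /bump leqNgt ltn_ord.
apply: (@eq_from_nth _ 0) => [|k].
  by rewrite size_rcons !size_perm_code.
rewrite size_perm_code => lt_k.
rewrite -[k]/(nat_of_ord (Ordinal lt_k)) nth_perm_code /nlarger.
case: (unliftP ord_max (Ordinal lt_k)) => [j|] ->; rewrite big_ord_recr.
  rewrite lift_max /= nth_rcons size_perm_code ltn_ord nth_perm_code.
  rewrite [n < j]ltnNge (ltnW (ltn_ord j)) addn0; apply: eq_bigr => i _.
  by rewrite widenE !lift_perm_lift /= ltn_bump2.
rewrite /= ltnn addn0 nth_rcons size_perm_code ltnn eqxx.
rewrite -(sum_leq_ord n v) [RHS](reindex_inj (@perm_inj _ s)); apply: eq_bigr => i _.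
rewrite widenE lift_perm_lift lift_perm_id /= ltn_ord /=; congr nat_of_bool.
by rewrite /bump; case: leqP; lia.
Qed.

(** A permutation is determined by its last value and the pattern of the rest; cardinality makes
    this injection a bijection. *)
Lemma sum_perm_lift (R : nmodType) n (F : 'S_n.+1 -> R) :
  (\sum_s F s = \sum_s \sum_(v < n.+1) F (lift_perm ord_max v s))%R.
Proof.
pose h (p : 'S_n * 'I_n.+1) := lift_perm ord_max p.2 p.1.
have h_inj : injective h.
  move=> [s v] [s' v'] /permP eq_h; have := eq_h ord_max.
  rewrite !lift_perm_id /= => eq_v; rewrite eq_v in eq_h *; congr (_, _).
  apply/permP => i; apply: (@lift_inj _ v').
  by have := eq_h (lift ord_max i); rewrite !lift_perm_lift.
have h_bij : bijective h.
  apply: inj_card_bij => //.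
  by rewrite card_prod !card_Sn card_ord factS mulnC.
rewrite (reindex h) /=; last exact: onW_bij.
by rewrite (pair_big xpredT xpredT (fun s v => F (lift_perm ord_max v s))).
Qed.

Lemma sum_perm_code (R : comNzRingType) n (f : seq nat -> R) :
  (\sum_(s : 'S_n) f (perm_code s) = code_sum n f)%R.
Proof.
elim: n f => [|n IHn] f /=.
  have code0 (s : 'S_0) : perm_code s = [::].
    by apply: size0nil; rewrite size_perm_code.
  under eq_bigr do rewrite code0.
  by rewrite sumr_const card_Sn.
rewrite sum_perm_lift -IHn; apply: eq_bigr => s _.
(* The new entry is [n - v]; reversing the values turns it into [v]. *)
rewrite (reindex_inj rev_ord_inj); apply: eq_bigr => v _.
by rewrite perm_code_lift /= subSS subKn // -ltnS.
Qed.

End PermutationCodes.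

(** * Occurrences of the pattern read off from the code *)

Section PatternOccurrences.
Local Open Scope nat_scope.
Variables (n : nat) (s : 'S_n).

(** The last clause at [c = i] encodes [s i < s j]; the boxes (0,0) and (0,1) merge into the clause
    before it. *)
Definition hits (i j : 'I_n) : bool :=
  [&& i < j, [forall c : 'I_n, (c < i) ==> (s j < s c)]
    & [forall c : 'I_n, (i <= c < j) ==> (s c < s j)]].

Lemma perm_ord_eq (i j : 'I_n) : s i = s j :> nat -> i = j.
Proof. by move/val_inj/perm_inj. Qed.

Lemma occurrenceE (a : {ffun 'I_2 -> 'I_n}) :
  occurrence pattern_p s a = hits (a ord0) (a ord_max).
Proof.
have enum2 : enum 'I_2 = [:: ord0; ord_max].
  by apply: (inj_map val_inj); rewrite val_enum_ord.
have ord2P (i : 'I_2) : i = ord0 \/ i = ord_max.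
  by case: i => [[|[|]]] // lt_i; [left | right]; apply: val_inj.
rewrite /occurrence /hits.
have -> : increasing_positions a = (a ord0 < a ord_max).
  apply/forallP/idP => [/(_ ord0)/forallP/(_ ord_max) //| lt_a i].
  apply/forallP => j; apply/implyP.
  by case: (ord2P i) => ->; case: (ord2P j) => ->.
case: ltnP => //= lt_a.
have -> : order_isomorphic pattern_p s a = (s (a ord0) < s (a ord_max)).
  apply/forallP/idP => [/(_ ord0)/forallP/(_ ord_max)|lt_s i].
    by rewrite /= !perm1 => /eqP.
  apply/forallP => j; rewrite /= !perm1.
  by case: (ord2P i) => ->; case: (ord2P j) => ->; rewrite ?ltnn ?lt_s //=;
    apply/eqP; apply/negbTE; rewrite -leqNgt ltnW.
have [lt_s|le_s] := ltnP (s (a ord0)) (s (a ord_max)); last first.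
  rewrite /=; apply/esym/negbTE/negP => /andP[_ /forallP/(_ (a ord0))].
  by rewrite leqnn lt_a /= ltnNge le_s.
rewrite /=; set i := a ord0; set j := a ord_max.
have pos : position_lines a = [:: 0; i.+1; j.+1; n.+1].
  by rewrite /position_lines enum2.
have vals : value_lines s a = [:: 0; (s i).+1; (s j).+1; n.+1].
  rewrite /value_lines enum2 /= sorted_sort //=; first exact: leq_trans.
  by rewrite andbT ltnS ltnW.
apply/forallP/andP => [box | [/forallP left_gt /forallP mid_lt] [x1 x2]].
  have nobox (x : 'I_3 * 'I_3) c : x \in mesh_shading pattern_p ->
    ~~ in_box s a x.1 x.2 c.
    by move=> x_in; have := box x; rewrite x_in negb_exists => /forallP/(_ c).
  split; apply/forallP => c; apply/implyP.
    move=> lt_ci.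
    have := nobox (inord 0, inord 0) c; have := nobox (inord 0, inord 1) c.
    rewrite !inE !eqxx !orbT /in_box pos vals /= !inordK //= => /(_ isT) + /(_ isT).
    (* Boxes are open, so the values [s i] and [s j] on their borders are excluded by
       injectivity. *)
    have nci : s c <> s i :> nat by move/perm_ord_eq => e; rewrite e ltnn in lt_ci.
    have ncj : s c <> s j :> nat.
      move/perm_ord_eq => e; rewrite e in lt_ci.
      by have := ltn_trans lt_ci lt_a; rewrite ltnn.
    lia.
  case/andP; rewrite leq_eqVlt => /orP[/eqP/val_inj <- //|lt_ic] lt_cj.
  have := nobox (inord 1, inord 2) c.
  rewrite !inE !eqxx !orbT /in_box pos vals /= !inordK //= => /(_ isT).
  have ncj : s c <> s j :> nat by move/perm_ord_eq => e; rewrite e ltnn in lt_cj.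
  have := ltn_ord (s c).
  lia.
apply/implyP; rewrite !inE negb_exists => x_in; apply/forallP => c.
have {left_gt} := implyP (left_gt c); have {mid_lt} := implyP (mid_lt c).
have lt_ij : s i < s j := lt_s.
by case/orP: x_in => [/orP[]|] /eqP[-> ->]; rewrite /in_box pos vals /= !inordK //=; lia.
Qed.

(** The values left of [j] that exceed [s j] are those before [i]; hence the right end determines
    the left one. *)
Lemma hits_nlarger i j : hits i j -> nlarger s j = i.
Proof.
case/and3P => lt_ij /forallP left_gt /forallP mid_lt.
rewrite -[RHS](minn_idPr (ltnW (ltn_ord i))) -sum_ltn_ord.
apply: eq_bigr => c _; congr nat_of_bool.
have := implyP (left_gt c); have := implyP (mid_lt c); lia.
Qed.

(** The left end can only be [nlarger s j]. The cut bounds counts of larger values; [below] turns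
    these bounds into comparisons of values. *)
Lemma code_hitE (j : 'I_n) : code_hit (perm_code s) j = [exists i, hits i j].
Proof.
have skewP i : skew_cut (take j (perm_code s)) i <->
    forall c : 'I_n, i <= c < j -> i <= nlarger s c.
  have sz : size (take j (perm_code s)) = j.
    by rewrite size_takel // size_perm_code ltnW.
  split => [/(all_nthP 0) cut c /andP[le_ic lt_cj] | cut].
    have := cut (c - i); rewrite size_drop sz nth_drop subnKC // nth_take //.
    by rewrite nth_perm_code; apply; lia.
  apply/(all_nthP 0) => k; rewrite size_drop sz nth_drop => lt_k.
  have lt_ikj : i + k < j by lia.
  rewrite nth_take //; have lt_ikn := ltn_trans lt_ikj (ltn_ord j).
  rewrite -[i + k]/(nat_of_ord (Ordinal lt_ikn)) nth_perm_code.
  by apply: cut => /=; lia.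
rewrite /code_hit nth_perm_code.
apply/andP/existsP => [[lt_j /skewP cut] | [i hit]]; last first.
  rewrite (hits_nlarger hit); case/and3P: hit => lt_ij /forallP left_gt /forallP mid_lt.
  split => //; apply/skewP => c /andP[le_ic lt_cj].
  rewrite -{1}(minn_idPr (ltnW (ltn_ord i))) -sum_ltn_ord.
  apply: leq_sum => x _.
  have := implyP (left_gt x); have := implyP (mid_lt c); lia.
set i := nlarger s j in lt_j cut.
have lt_in : i < n by apply: ltn_trans lt_j _.
pose i0 := Ordinal lt_in.
(* Were some earlier value below [s c], the at least [i] larger values to the
   left of [c] would all sit in the first [i] positions, minus that one. *)
have below (c x : 'I_n) : i <= c <= j -> x < i -> s c < s x.
  have [m] := ubnP c; elim: m c x => // m IHm c x lt_cm /andP[le_ic le_cj] lt_xi.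
  rewrite ltnNge; apply/negP => le_xc.
  have : i <= nlarger s c.
    move: le_cj; rewrite leq_eqVlt => /orP[/eqP/val_inj -> //|lt_cj].
    by apply: cut; rewrite le_ic.
  apply/negP; rewrite -ltnNge.
  suff : nlarger s c < \sum_(y < n) (y < i).
    by rewrite sum_ltn_ord (minn_idPr (ltnW lt_in)).
  rewrite /nlarger (bigD1 x) //= [X in _ < X](bigD1 x) //= lt_xi.
  rewrite [s c < s x]ltnNge le_xc andbF add0n add1n ltnS.
  apply: leq_sum => y _; case: (ltnP y i) => lt_yi; first exact: leq_b1.
  case: (ltnP y c) => //= lt_yc.
  have := IHm y x (leq_trans lt_yc lt_cm); rewrite lt_yi (ltnW (leq_trans lt_yc le_cj)).
  move=> /(_ isT lt_xi); lia.
exists i0; apply/and3P; split => //.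
  apply/forallP => c; apply/implyP; apply: below.
  by rewrite leqnn andbT ltnW.
apply/forallP => c; apply/implyP => /andP[le_ic lt_cj].
rewrite ltnNge; apply/negP => le_jc.
(* Such a [c], with the [i] positions before [i], would give more than [i] larger values left of
   [j]. *)
suff : \sum_(y < n) (y < i) < nlarger s j.
  by rewrite sum_ltn_ord (minn_idPr (ltnW lt_in)) ltnn.
rewrite /nlarger (bigD1 c) //= [X in _ < X](bigD1 c) //= lt_cj [c < i]ltnNge le_ic.
have -> : s j < s c.
  rewrite ltn_neqAle le_jc andbT; apply/eqP => /perm_ord_eq e.
  by rewrite e ltnn in lt_cj.
rewrite add0n add1n ltnS; apply: leq_sum => y _.
case: (ltnP y i) => //= lt_yi.
have -> : s j < s y by apply: below lt_yi; rewrite leqnn andbT ltnW.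
by rewrite (ltn_trans lt_yi lt_j).
Qed.

(** Sending an occurrence to its right end is injective by [hits_nlarger], and the image consists of
    the hits. *)
Lemma mesh_count_code : mesh_count pattern_p s = code_count (perm_code s).
Proof.
transitivity #|[set j : 'I_n | [exists i, hits i j]]|; last first.
  rewrite /code_count size_perm_code -sum1_card big_mkcond /=.
  by apply: eq_bigr => j _; rewrite inE code_hitE; case: ifP.
rewrite /mesh_count.
have inj : {in [set a | occurrence pattern_p s a] &,
             injective (fun a : {ffun 'I_2 -> 'I_n} => a ord_max)}.
  move=> a b; rewrite !inE !occurrenceE.
  move=> /hits_nlarger ha /hits_nlarger hb eq_ab.
  apply/ffunP => -[[|[|//]] lt_i]; last first.
    by rewrite (_ : Ordinal lt_i = ord_max) //; apply: val_inj.
  rewrite (_ : Ordinal lt_i = ord0); last exact: val_inj.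
  by apply: val_inj; rewrite /= -ha -hb eq_ab.
rewrite -(card_in_imset inj); apply: eq_card => j; rewrite inE.
apply/imsetP/existsP => [[a]|[i hit]].
  by rewrite inE occurrenceE => hit ->; exists (a ord0).
exists [ffun k : 'I_2 => if k == ord0 then i else j]; last by rewrite ffunE.
by rewrite inE occurrenceE !ffunE.
Qed.

End PatternOccurrences.

Theorem corollary1p8 (alpha : nat -> {poly int})
  (alpha_odd : forall k : nat, (1 <= k)%N -> alpha (2 * k - 1)%N = k%:R)
  (alpha_even : forall k : nat, (1 <= k)%N -> alpha (2 * k)%N = 'X + k%:R - 1) :
  is_sfraction (mesh_series pattern_p) alpha.
Proof.
have seriesE n : mesh_series pattern_p n = code_poly 'X n.
  rewrite /code_poly -sum_perm_code; apply: eq_bigr => s _.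
  by rewrite mesh_count_code.
have euler0 n : euler_series 'X 0 n = rising ('X - 1 : {poly int}) n.
  by rewrite /euler_series /= addn0 binn mul1r addr0.
have euler1 n : euler_series 'X 1 n = rising ('X : {poly int}) n.
  by rewrite /euler_series /= addn0 binn mul1r addrK.
have rec i n : euler_series 'X i.+1 n.+1 - euler_series 'X i n.+1
               = alpha i.+1 * euler_series 'X i.+2 n.
  rewrite -[i]odd_double_half; case: (odd i); rewrite ?add1n ?add0n.
    rewrite euler_seriesB_odd -doubleS -mul2n alpha_even //.
    by rewrite -natr1 addrA addrK.
  by rewrite euler_seriesB_even -alpha_odd // mul2n doubleS subn1.
(* Multiplied by the series of [rising ('X - 1)], both sides agree with the series of [rising 'X]
   below order [N]. *)
move=> N; exists N => m le_Nm; apply: (fps_mulI (euler_series0 'X 0)) => n lt_nN.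
rewrite (sfraction_ratio (euler_series0 'X) rec) ?(leq_trans (ltnW lt_nN)) //.
rewrite euler1 -(riccati_rising (code_poly0 _) (code_polyS _)).
by apply: eq_bigr => i _; rewrite seriesE euler0.
Qed.
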